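(* Let $\mathbf{A} \in \{0,1\}^{d\times n}$ with columns $\mathbf{a}_1,\dots,\mathbf{a}_n$, let $k\ge 1$, and let $(\mathbf{U},\mathbf{V})$, $\mathbf{U}\in\{0,1\}^{d\times k}$, $\mathbf{V}\in\{0,1\}^{k\times n}$, be a fixed optimal solution of $\min_{\mathbf{U},\mathbf{V}}\|\mathbf{A}-\mathbf{U}\mathbf{V}\|_F^2$ over $\mathrm{GF}(2)$, with optimal value $\mathrm{OPT}_k$. Let $\mathbf{b}_1,\dots,\mathbf{b}_k$ be $k$ linearly independent vectors in $\{0,1\}^k = \mathrm{GF}(2)^k$. Then for each $0 \le r \le k$, \[ \mathrm{Err}^{(r)}(\mathbf{b}_1,\dots,\mathbf{b}_{k-r}) \le \mathrm{OPT}_k + \lambda_r \sum_{\mathbf{c} \in \mathrm{span}^c(\mathbf{b}_1,\dots,\mathbf{b}_{k-r})} L_{\mathbf{c}} + \sum_{i=1}^{k-r} f_i(\mathbf{b}_1,\dots,\mathbf{b}_{k-r})\, M_{\mathbf{b}_i}, \] where $\lambda_0 = 0$, $\lambda_r = \frac{r}{2}\left(1 + \frac{1}{2^r-1}\right)$ for $1 \le r \le k$, and \[ f_i(\mathbf{b}_1,\dots,\mathbf{b}_{k-r}) = N_{\mathcal{X}_i} + \tfrac{1}{2} N_{\mathcal{Y}},\quad \mathcal{X}_i = \mathbf{b}_i + \mathrm{span}^{\backslash i}(\mathbf{b}_1,\dots,\mathbf{b}_{k-r}),\quad \mathcal{Y} = \mathrm{span}^c(\mathbf{b}_1,\dots,\mathbf{b}_{k-r}).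 \]
   Context: All vector/matrix arithmetic is over $\mathrm{GF}(2)$; for a binary vector or matrix, $|\cdot|$ and $\|\cdot\|_F^2$ denote the number of entries equal to $1$ (Hamming weight). Spans: for vectors $\mathbf{b}_1,\dots,\mathbf{b}_s \in \{0,1\}^k$, $\mathrm{span}$ is the $\mathrm{GF}(2)$-linear span (the span of no vectors is $\{\mathbf{0}\}$); $\mathrm{span}^c(\mathbf{b}_1,\dots,\mathbf{b}_s) := \{0,1\}^k \setminus \mathrm{span}(\mathbf{b}_1,\dots,\mathbf{b}_s)$; $\mathrm{span}^{\backslash i}(\mathbf{b}_1,\dots,\mathbf{b}_s) := \mathrm{span}(\mathbf{b}_1,\dots,\mathbf{b}_{i-1},\mathbf{b}_{i+1},\dots,\mathbf{b}_s)$. Nearest neighbors: for $\mathbf{u} \in \{0,1\}^d$, $\mathbf{a}_{(\mathbf{u})}$ is a column of $\mathbf{A}$ minimizing $|\mathbf{a}_j - \mathbf{u}|$ (ties broken arbitrarily but fixed). Quantities depending on the fixed $(\mathbf{U},\mathbf{V})$: for $\mathbf{c}\in\{0,1\}^k$, $\mathcal{J}_{\mathbf{c}} := \{j \in [n] : \text{the } j\text{th column of } \mathbf{V} \text{ equals } \mathbf{c}\}$, $n_{\mathbf{c}} := |\mathcal{J}_{\mathbf{c}}|$, $L_{\mathbf{c}} := \sum_{j\in\mathcal{J}_{\mathbf{c}}} |\mathbf{a}_j - \mathbf{U}\mathbf{c}|$, $M_{\mathbf{c}} := L_{\mathbf{c}}/n_{\mathbf{c}}$ if $n_{\mathbf{c}}>0$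 and $M_{\mathbf{c}} := d$ if $n_{\mathbf{c}}=0$; for $\mathcal{X}\subseteq\{0,1\}^k$, $N_{\mathcal{X}} := \sum_{\mathbf{c}\in\mathcal{X}} n_{\mathbf{c}}$. Errors: for any $\mathbf{b}_1,\dots,\mathbf{b}_k \in \{0,1\}^k$, let $\mathbf{B} = (\mathbf{b}_1,\dots,\mathbf{b}_k)$, $\mathbf{A}_{(\mathbf{U}\mathbf{B})} := (\mathbf{a}_{(\mathbf{U}\mathbf{b}_1)},\dots,\mathbf{a}_{(\mathbf{U}\mathbf{b}_k)}) \in \{0,1\}^{d\times k}$, and $\mathrm{Err}(\mathbf{b}_1,\dots,\mathbf{b}_k) := \min_{\mathbf{Q}\in\{0,1\}^{k\times n}} \|\mathbf{A} - \mathbf{A}_{(\mathbf{U}\mathbf{B})}\mathbf{Q}\|_F^2$. Define recursively $\mathrm{Err}^{(0)} := \mathrm{Err}$ and, for $1\le r\le k$, $\mathrm{Err}^{(r)}(\mathbf{b}_1,\dots,\mathbf{b}_{k-r}) := \min_{\mathbf{b}\in\{0,1\}^k} \mathrm{Err}^{(r-1)}(\mathbf{b}_1,\dots,\mathbf{b}_{k-r},\mathbf{b})$ (for $r=k$ this is a number with no arguments). *)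

(* Defs.v *)
From HB Require Import structures.
From mathcomp Require Import all_boot all_order all_algebra.

Set Implicit Arguments.
Unset Strict Implicit.
Unset Printing Implicit Defensive.

Import Order.TTheory GRing.Theory Num.Theory.
Local Open Scope ring_scope.

(* The least value of F on a finite type; x0 only witnesses nonemptiness. *)
Definition minval (T : finType) (x0 : T) (F : T -> nat) : nat :=
  F [arg min_(x < x0) F x].

Definition hw (m n : nat) (X : 'M['F_2]_(m, n)) : nat :=
  #|[set ij : 'I_m * 'I_n | X ij.1 ij.2 == 1]|.

Definition OPT (d n : nat) (A : 'M['F_2]_(d, n)) (k : nat) : nat :=
  minval ((0, 0) : 'M['F_2]_(d, k) * 'M['F_2]_(k, n))
         (fun UV => hw (A - UV.1 *m UV.2)).

Definition optimal (d n k : nat) (A : 'M['F_2]_(d, n))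
    (U : 'M['F_2]_(d, k)) (V : 'M['F_2]_(k, n)) : Prop :=
  hw (A - U *m V) = OPT A k.

(* nn fixes, for each u, the index of the column a_(u) of A: ties are broken
   by an arbitrary such function. *)
Definition nearest (d n : nat) (A : 'M['F_2]_(d, n))
    (nn : 'cV['F_2]_d -> 'I_n) : Prop :=
  forall (u : 'cV['F_2]_d) (j : 'I_n),
    (hw (col (nn u) A - u) <= hw (col j A - u))%N.

Section Fixed.
Variables (d n k : nat).
Variables (A : 'M['F_2]_(d, n)) (U : 'M['F_2]_(d, k)) (V : 'M['F_2]_(k, n)).
Variable nn : 'cV['F_2]_d -> 'I_n.
Implicit Types (c : 'cV['F_2]_k) (s : seq 'cV['F_2]_k).
Implicit Types (X : {set 'cV['F_2]_k}).

Definition Jset c : {set 'I_n} := [set j | col j V == c].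

Definition ncard c : nat := #|Jset c|.

Definition Lsum c : nat := \sum_(j in Jset c) hw (col j A - U *m c).

Definition Mavg c : rat :=
  if (0 < ncard c)%N then (Lsum c)%:R / (ncard c)%:R else d%:R.

Definition Nsum X : nat := \sum_(c in X) ncard c.

Definition spanset s : {set 'cV['F_2]_k} := [set c | c \in <<s>>%VS].

Definition spanC s : {set 'cV['F_2]_k} := ~: spanset s.

(* Indices start at 0: the i-th entry of s is s`_i with i < size s. *)
Definition span_but s (i : nat) : {set 'cV['F_2]_k} :=
  spanset (take i s ++ drop i.+1 s).

Definition A_UB s : 'M['F_2]_(d, size s) :=
  \matrix_(i < d, j < size s) A i (nn (U *m s`_j)).

(* The arguments b_1, ..., b_m of the errors are packed as a list s of length
   m; Err is meant for lists of length k, and Err_rec r for length k - r. *)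
Definition Err s : nat :=
  minval (0 : 'M['F_2]_(size s, n)) (fun Q => hw (A - A_UB s *m Q)).

Fixpoint Err_rec (r : nat) s : nat :=
  if r is r'.+1 then
    minval (0 : 'cV['F_2]_k) (fun b => Err_rec r' (rcons s b))
  else Err s.

Definition Xset s (i : nat) : {set 'cV['F_2]_k} :=
  [set s`_i + v | v in span_but s i].

Definition fcoef s (i : nat) : rat :=
  (Nsum (Xset s i))%:R + 2^-1 * (Nsum (spanC s))%:R.

End Fixed.

Definition lambda (r : nat) : rat :=
  if r == 0%N then 0 else r%:R / 2 * (1 + 1 / (2 ^+ r - 1)).

(* Main.v *)
(** Induction on r.  For r = 0, decode column j of A with the coordinates of
    column j of V in the basis b_1, ..., b_k: the error of the column grows by
    at most |a_(U b_i) - U b_i| <= M_(b_i) for every b_i that occurs.  For the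
    step, let S be the span of the given vectors and Y its complement.  Draw
    the next vector b from one coset C = b0 + S inside Y, with probability
    n_b / N_C.
    Then n_b M_b = L_b turns the new term into (N_Y + N_C) L_C / 2N_C, and the
    coefficients f_i do not increase on average: X_i and its complement in S cut
    C into halves of masses x0, x1 and the change of f_i averages to
    -(x0 - x1)^2 / 2N_C.  A suitable coset among the m = 2^r - 1 ones exists
    because t / (1/2 - (lambda_(r-1) - 1/2) t) is convex in t = N_C / N_Y, and
    lambda_r is the constant that Jensen's inequality yields. *)

Require Import Defs.
From HB Require Import structures.
From mathcomp Require Import all_boot all_order all_algebra finfield.
From mathcomp Require Import ring lra.
Set Implicit Arguments.
Unset Strict Implicit.
Unset Printing Implicit Defensive.
Import Order.TTheory GRing.Theory Num.Theory.
Local Open Scope ring_scope.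

(** * Convexity and averaging inequalities *)

(* The left side is 1/2 - (lam - 1/2) t times the distance of the convex
   function delta t / (1/2 - (lam - 1/2) t) to its tangent at t = 1/m. *)
Lemma tangent_gap (R : realFieldType) (lam m t : R) :
  let delta := 2^-1 - (lam - 2^-1) / m in 0 < m -> 0 < delta ->
  delta * t - (2^-1 - (lam - 2^-1) * t) * (m^-1 + (t - m^-1) / (2 * delta)) =
  (lam - 2^-1) / (2 * delta) * (t - m^-1) ^+ 2.
Proof.
move=> delta m0 d0.
have [m1 d1] : m != 0 /\ delta != 0 by rewrite !gt_eqF.
have -> : lam - 2^-1 = (2^-1 - delta) * m by rewrite /delta; field.
by clearbody delta; field; rewrite d1 m1.
Qed.

(* The cosets b + S are indexed by their elements b, so each of them is counted
   w = |S| times: x b and y b stand for N_C and L_C. *)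
Lemma weighted_choice (R : realFieldType) (T : finType) (Y : {set T})
    (x y : T -> R) (lam m w N L : R) :
  let delta := 2^-1 - (lam - 2^-1) / m in
  {in Y, forall b, 0 <= x b} -> {in Y, forall b, 0 <= y b} ->
  \sum_(b in Y) x b = w * N -> \sum_(b in Y) y b = w * L ->
  #|Y|%:R = m * w -> 0 < w -> 0 < m -> 0 < N -> 0 <= L -> 0 < delta ->
  2^-1 <= lam \/ (m = 1 /\ {in Y, forall b, x b = N}) ->
  exists b, [/\ b \in Y, 0 < x b &
    2^-1 * (N + x b) * y b + x b * (lam * (L - y b))
      <= x b * ((lam + delta) * L)].
Proof.
move=> delta x0 y0 sx sy cY w0 m0 N0 L0 d0 lamP.
pose good b := (b \in Y) && (0 < x b) && (2^-1 * (N + x b) * y b +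
  x b * (lam * (L - y b)) <= x b * ((lam + delta) * L)).
case: (pickP good) => [b /andP[/andP[bY xb] H]|bad]; first by exists b.
exfalso.
(* The tangent at 1/m, the mean of [x b / N] over [Y], scaled by [L]. Its sum over [Y] is [w * L],
   the same as that of [y], so it is enough to show that [y] stays above it and is strictly above it
   somewhere. *)
pose line b := L * (m^-1 + (x b / N - m^-1) / (2 * delta)).
have slt b : b \in Y -> 0 < x b -> line b < y b.
  move=> bY xb; move: (bad b); rewrite /good bY xb /= => /negbT;
    rewrite -ltNge => H.
  have gap := tangent_gap (x b / N) m0 d0.
  rewrite -/delta in gap.
  set t := x b / N in gap; have xE : x b = t * N by rewrite /t divfK ?gt_eqF.
  have t0 : 0 < t by rewrite divr_gt0.
  have H1 : t * delta * L < (2^-1 - (lam - 2^-1) * t) * y b.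
    rewrite -(ltr_pM2l N0) -subr_gt0; move: H; rewrite -subr_gt0 xE.
    by congr (0 < _); ring.
  have yb := y0 b bY.
  (* By [H1] the product of this factor and [y b >= 0] exceeds a nonnegative number, so the factor
     is positive. *)
  have h0 : 0 < 2^-1 - (lam - 2^-1) * t.
    rewrite ltNge; apply/negP => h.
    have := le_lt_trans (mulr_ge0 (mulr_ge0 (ltW t0) (ltW d0)) L0) H1.
    by rewrite ltNge mulr_le0_ge0.
  (* Either [lam >= 2^-1] makes the function convex, or [t = 1 = m^-1] is the point of tangency and
     the gap vanishes. *)
  have gap0 : 0 <= (lam - 2^-1) / (2 * delta) * (t - m^-1) ^+ 2.
    case: lamP => [hl|[-> xN]].
      by rewrite mulr_ge0 ?sqr_ge0 // divr_ge0 ?subr_ge0 // mulr_ge0 // ltW.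
    by rewrite /t xN // divff ?gt_eqF // invr1 subrr expr0n mulr0.
  rewrite -(ltr_pM2l h0); apply: le_lt_trans H1.
  rewrite /line -/t; move: gap0; rewrite -gap subr_ge0 => /(ler_wpM2r L0).
  by rewrite [t * delta]mulrC; congr (_ <= _); ring.
(* When [x b = 0], failure of the inequality says nothing about [y b]; but there the tangent is at
   most 0, because [delta <= 2^-1]. *)
have sle b : b \in Y -> line b <= y b.
  move=> bY; have := x0 b bY; rewrite le_eqVlt => /orP[/eqP xb|xb]; last first.
    exact/ltW/slt.
  apply: le_trans (y0 b bY); rewrite /line -xb mul0r sub0r.
  apply: mulr_ge0_le0 => //.
  case: lamP => [hl|[_ xN]]; last by move: N0; rewrite -(xN b bY) -xb ltxx.
  have d2 : delta <= 2^-1.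
    by rewrite /delta lerBlDr lerDl divr_ge0 ?subr_ge0 // ltW.
  rewrite mulNr subr_le0 ler_pdivlMr ?mulr_gt0 //.
  rewrite -[leRHS]mulr1 ler_wpM2l ?invr_ge0 ?(ltW m0) //; lra.
have [b bY xb] : exists2 b, b \in Y & 0 < x b.
  case: (pickP (fun b => (b \in Y) && (0 < x b))) => [b /andP[? ?]|no];
    first by exists b.
  suff : \sum_(b in Y) x b <= 0 by rewrite sx leNgt mulr_gt0.
  by apply: sumr_le0 => b bY; move: (no b); rewrite bY /= => /negbT;
    rewrite -leNgt.
have : \sum_(b in Y) line b < \sum_(b in Y) y b.
  rewrite (bigD1 b) //= [ltRHS](bigD1 b) //=; apply: ltr_leD; first exact: slt.
  by apply: ler_sum => c /andP[cY0 _]; apply: sle.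
rewrite sy /line -mulr_sumr big_split /= -mulr_suml big_split /= -mulr_suml sx.
rewrite !sumr_const -[_ *+ #|_|]mulr_natr -[(- m^-1) *+ #|_|]mulr_natr cY.
rewrite mulfK ?gt_eqF // mulNr !mulKf ?gt_eqF // subrr mul0r addr0 mulrC.
by rewrite ltxx.
Qed.

(** Serves to pick one member of a coset with weights n_b: if every [f i] exceeded [t], a single
    positive weight would push the weighted sum strictly above [t] times the total weight. *)
Lemma exists_le_average (R : realFieldType) (I : finType) (P : pred I)
    (w f : I -> R) (t : R) :
  (forall i, P i -> 0 <= w i) -> 0 < \sum_(i | P i) w i ->
  \sum_(i | P i) w i * f i <= (\sum_(i | P i) w i) * t ->
  exists2 i, P i & f i <= t.
Proof.
move=> w0 sw; rewrite mulr_suml => le.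
case: (pickP (fun i => P i && (f i <= t))) => [i /andP[? ?]|no];
  first by exists i.
have lt i : P i -> t < f i by move=> Pi; move: (no i);
  rewrite Pi ltNge => /= ->.
have [i Pi wi] : exists2 i, P i & 0 < w i.
  case: (pickP (fun i => P i && (0 < w i))) => [i /andP[? ?]|no'];
    first by exists i.
  move: sw; rewrite ltNge sumr_le0 // => i Pi.
  by move: (no' i); rewrite Pi ltNge => /negbFE.
move: le; rewrite leNgt => /negP[].
rewrite (bigD1 i) //= [ltRHS](bigD1 i) //=; apply: ltr_leD.
  by rewrite ltr_pM2l // lt.
by apply: ler_sum => j /andP[Pj _]; rewrite ler_wpM2l ?w0 // ltW ?lt.
Qed.

(** * The constants lambda_r *)

(** The increment is the [delta] of [weighted_choice] for [lam = lambda r] and m = 2^(r+1) - 1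
    cosets. *)
Lemma lambda_recS (r : nat) :
  lambda r.+1 = lambda r + (2^-1 - (lambda r - 2^-1) / (2 ^+ r.+1 - 1)).
Proof.
rewrite /lambda /=; case: r => [|r] /=; first by [].
have : 2%:R <= (2 : rat) ^+ r.+1.
  by rewrite -natrX ler_nat -{1}(expn1 2) leq_exp2l.
rewrite [2 ^+ r.+2]exprS; move: (2 ^+ r.+1) => p p2.
by rewrite [r.+2%:R]mulrS; field; rewrite !gt_eqF; lra.
Qed.

(** Equivalent to positivity of that increment. *)
Lemma lambda_lt (r : nat) : lambda r < 2 ^+ r.
Proof.
rewrite /lambda; case: r => [|r] /=; first by [].
have : (r.+1%:R : rat) + 1 <= 2 ^+ r.+1.
  by rewrite -natrX natr1 ler_nat ltn_expl.
have : (1 : rat) <= r.+1%:R by rewrite ler1n.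
move: (2 ^+ r.+1) (r.+1%:R) => p q q1 pq.
have p1 : 0 < p - 1 by lra.
rewrite (_ : _ * _ = q / 2 * p / (p - 1)); last by field; rewrite gt_eqF.
rewrite ltr_pdivrMr //; nra.
Qed.

(** Supplies the convexity needed in [weighted_choice]; it starts at index 1 because
    [lambda 0 = 0]. *)
Lemma lambda_ge_half (r : nat) : 2^-1 <= lambda r.+1.
Proof.
rewrite /lambda /=.
have : 1 <= (2 : rat) ^+ r.+1 by rewrite exprn_ege1 // ler1n.
rewrite -subr_ge0 -invr_ge0 -[X in 0 <= X]mul1r.
have : (1 : rat) <= r.+1%:R by rewrite ler1n.
move: (1 / _) (r.+1%:R) => p q q1 p0; nra.
Qed.

(** * Minima and Hamming weights over GF(2) *)

Lemma minval_le (T : finType) (x0 : T) (F : T -> nat) (x : T) :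
  (minval x0 F <= F x)%N.
Proof. by rewrite /minval; case: arg_minnP => // i _ /(_ x); apply. Qed.

Lemma F2_cases (a : 'F_2) : a = 0 \/ a = 1.
Proof. by case: a => [[|[|//]] ?]; [left|right]; apply: val_inj. Qed.

Lemma oppmx_F2 (m n : nat) (X : 'M['F_2]_(m, n)) : - X = X.
Proof. by apply/matrixP=> i j; rewrite mxE; case: (F2_cases (X i j)) => ->;
  apply: val_inj. Qed.

Lemma addmx_F2 (m n : nat) (X : 'M['F_2]_(m, n)) : X + X = 0.
Proof. by rewrite -{2}[X]oppmx_F2 subrr. Qed.

Section Hamming.
Variables m n : nat.
Implicit Types X Y : 'M['F_2]_(m, n).

Lemma hwE X : hw X = (\sum_(j < n) \sum_(i < m) (X i j == 1%R))%N.
Proof.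
rewrite exchange_big pair_big /= /hw -sum1_card.
by rewrite big_mkcond; apply: eq_bigr => ij _; rewrite inE; case: eqP.
Qed.

Lemma hwD X Y : (hw (X + Y) <= hw X + hw Y)%N.
Proof.
rewrite !hwE -big_split leq_sum // => j _.
rewrite -big_split leq_sum // => i _ /=; rewrite mxE.
by case: (F2_cases (X i j)) => ->; case: (F2_cases (Y i j)) => ->.
Qed.

Lemma hw_sum (I : finType) (F : I -> 'M['F_2]_(m, n)) :
  (hw (\sum_i F i)%R <= \sum_i hw (F i))%N.
Proof.
elim/big_rec2: _ => [|i x y _ IH].
  by rewrite hwE big1 // => j _; rewrite big1 // => i _; rewrite mxE.
by rewrite (leq_trans (hwD _ _)) ?leq_add2l.
Qed.

Lemma hwZ (a : 'F_2) X : hw (a *: X) = ((a == 1%R) * hw X)%N.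
Proof.
case: (F2_cases a) => ->; last by rewrite scale1r mul1n.
by rewrite scale0r hwE big1 // => j _; rewrite big1 // => i _; rewrite mxE.
Qed.

Lemma hw_le X : (hw X <= m * n)%N.
Proof. by rewrite (leq_trans (max_card _)) // card_prod !card_ord. Qed.

End Hamming.

Lemma hw_col (m n : nat) (X : 'M['F_2]_(m, n)) :
  hw X = (\sum_j hw (col j X))%N.
Proof.
rewrite hwE; apply: eq_bigr => j _; rewrite hwE big_ord_recl big_ord0 addn0.
by apply: eq_bigr => i _; rewrite mxE.
Qed.

(** * Spans, cosets and sums over them *)

Section Spans.
Variable k : nat.
Local Notation E := 'cV['F_2]_k.
Implicit Types (W : {vspace E}) (b c : E) (s : seq E).

(** Over GF(2) the line through [b] is {0, b} and -b = b, so [W + <[b]>] is the union of [W] and b +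
    W. *)
Lemma memv_add_line W b c :
  (c \in (W + <[b]>)%VS) = (c \in W) || (b + c \in W).
Proof.
apply/memv_addP/orP => [[u uW [v /vlineP[a ->] ->]]|[cW|cW]].
- case: (F2_cases a) => ->; first by rewrite scale0r addr0; left.
  by rewrite scale1r addrCA addmx_F2 addr0; right.
- by exists c => //; exists 0; rewrite ?mem0v ?addr0.
- exists (b + c) => //; exists b; first exact: memv_line.
  by rewrite addrAC addmx_F2 add0r.
Qed.

Lemma span_rcons s b : <<rcons s b>>%VS = (<<s>> + <[b]>)%VS.
Proof. by rewrite -cats1 span_cat span_seq1. Qed.

Lemma free_rcons s b : free (rcons s b) = (b \notin <<s>>%VS) && free s.
Proof. by rewrite -free_cons; apply/perm_free; rewrite perm_rcons. Qed.

Lemma perm_but s i : (i < size s)%N ->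
  perm_eq s (s`_i :: take i s ++ drop i.+1 s).
Proof.
by move=> h; rewrite -{1}(cat_take_drop i s) (drop_nth 0 h) (perm_catCA _ [::
  s`_i]).
Qed.

Lemma free_but s i : free s -> (i < size s)%N ->
  s`_i \notin <<take i s ++ drop i.+1 s>>%VS.
Proof. by move=> fs /perm_but/perm_free;
  rewrite fs free_cons => /esym/andP[]. Qed.

Lemma span_butE s i : (i < size s)%N ->
  <<s>>%VS = (<<take i s ++ drop i.+1 s>> + <[s`_i]>)%VS.
Proof.
by move=> h; rewrite -span_rcons; apply/eq_span => c;
  rewrite (perm_mem (perm_but h)) mem_rcons.
Qed.

Lemma XsetE s i c :
  (c \in Xset s i) = (s`_i + c \in <<take i s ++ drop i.+1 s>>%VS).
Proof.
apply/imsetP/idP => [[v]|h]; first by rewrite !inE => vH ->;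
  rewrite addrA addmx_F2 add0r.
by exists (s`_i + c); rewrite ?inE // addrA addmx_F2 add0r.
Qed.

Lemma sum_translate (R : nmodType) W (F : E -> R) b : b \in W ->
  \sum_(v in W) F (b + v) = \sum_(v in W) F v.
Proof.
move=> bW; rewrite [RHS](reindex_inj (addrI b)) /=.
by apply: eq_bigl => v; rewrite rpredDl.
Qed.

Lemma sum_coset (R : nmodType) W (F : E -> R) b :
  \sum_(c | b + c \in W) F c = \sum_(v in W) F (b + v).
Proof.
rewrite (reindex_inj (addrI b)) /=.
by apply: eq_bigl => v; rewrite addrA addmx_F2 add0r.
Qed.

Lemma sum_memv_line (R : nmodType) W (F : E -> R) b : b \notin W ->
  \sum_(c in (W + <[b]>)%VS) F c =
  \sum_(c in W) F c + \sum_(c | b + c \in W) F c.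
Proof.
move=> bW; rewrite (bigID (mem W)) /=; congr (_ + _); apply: eq_bigl => c.
  by rewrite memv_add_line; case: (c \in W); rewrite ?andbF.
rewrite memv_add_line; case cW: (c \in W) => //=; last by rewrite andbT.
by rewrite rpredDr // (negPf bW).
Qed.

Lemma sum_spanC_rcons (R : zmodType) s (F : E -> R) b : b \notin <<s>>%VS ->
  \sum_(c in spanC (rcons s b)) F c =
  \sum_(c in spanC s) F c - \sum_(v in <<s>>%VS) F (b + v).
Proof.
move=> bs; rewrite -sum_coset.
rewrite [X in _ = X - _](bigID (fun c => b + c \in <<s>>%VS)) /=.
rewrite [X in X + _ - _](eq_bigl (fun c => b + c \in <<s>>%VS)) => [|c];
  last first.
  rewrite !inE; case cs: (b + c \in _); rewrite ?andbF ?andbT //.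
  by apply/negP => h; move/negP: bs; rewrite -(rpredDr b h).
rewrite addrAC subrr add0r; apply: eq_bigl => c.
by rewrite !inE span_rcons memv_add_line negb_or.
Qed.

(** For each fixed [v] in [W] the translation by [v] permutes [Y], so all of [Y] is counted once per
    element of [W]. *)
Lemma sum_Y_coset (R : nmodType) W (F : E -> R) (Y : {set E}) :
  (forall c, (c \in Y) = (c \notin W)) ->
  \sum_(b in Y) \sum_(v in W) F (b + v) = (\sum_(c in Y) F c) *+ #|W|.
Proof.
move=> YE; rewrite exchange_big /= -sumr_const; apply: eq_bigr => v vW.
rewrite [RHS](reindex_inj (addIr v)) /=; apply: eq_bigl => c.
by rewrite !YE rpredDr.
Qed.

(** [W] cuts the coset of [b] into two halves on which [F] has sums x0 and x1, and the inner sum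
    runs over the half opposite to [b + v]. The left side is therefore 2 x0 x1, which is at most (x0
    + x1)^2 / 2. *)
Lemma coset_cross_le (R : realFieldType) W (F : E -> R) b e : e \notin W ->
  \sum_(v in (W + <[e]>)%VS) F (b + v) * (\sum_(x | e + x \in W) F (b + v + x))
  <= 2^-1 * (\sum_(v in (W + <[e]>)%VS) F (b + v)) ^+ 2.
Proof.
move=> eW; rewrite !sum_memv_line //.
set x0 := \sum_(v in W) F (b + v); set x1 := \sum_(v | e + v \in W) F (b + v).
have -> : \sum_(v in W) F (b + v) * (\sum_(x | e + x \in W) F (b + v + x)) = x0
  * x1.
  rewrite mulr_suml; apply: eq_bigr => v vW; congr (_ * _).
  rewrite /x1 [RHS](reindex_inj (addrI v)) /=; apply: eq_big => x.
    by rewrite addrCA (rpredDl _ vW).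
  by rewrite addrA.
have -> : \sum_(v | e + v \in W) F (b + v) * (\sum_(x | e + x \in W) F (b + v +
  x)) = x1 * x0.
  rewrite mulr_suml; apply: eq_bigr => v vW; congr (_ * _).
  rewrite /x0 [RHS](reindex_inj (addrI v)) /=; apply: eq_big => x;
    last by rewrite addrA.
  have -> : v + x = (e + v) + (e + x) by rewrite addrACA addmx_F2 add0r.
  by rewrite (rpredDl _ vW).
rewrite -subr_ge0 (_ : _ - _ = 2^-1 * (x0 - x1) ^+ 2); last by field.
by rewrite mulr_ge0 ?sqr_ge0 ?invr_ge0 ?ler0n.
Qed.

End Spans.

(** * The case r = 0: decoding in a basis *)

Section Fixed.
Variables (d n k : nat).
Variables (A : 'M['F_2]_(d, n)) (U : 'M['F_2]_(d, k)) (V : 'M['F_2]_(k, n)).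
Variable nn : 'cV['F_2]_d -> 'I_n.
Hypothesis hopt : optimal A U V.
Hypothesis hnn : nearest A nn.
Local Notation E := 'cV['F_2]_k.
Implicit Types (W : {vspace E}) (b c : E) (s : seq E).

Lemma sum_Jset (X : {set E}) (G : E -> 'I_n -> nat) :
  (\sum_(c in X) \sum_(j in Jset V c) G c j =
   \sum_(j | col j V \in X) G (col j V) j)%N.
Proof.
rewrite [RHS](partition_big (fun j => col j V) (mem X)) //=.
apply: eq_bigr => c cX; apply: eq_big => [j|j]; rewrite inE.
  by apply/eqP/andP => [->|[_ /eqP]//]; rewrite cX.
by move/eqP->.
Qed.

Lemma Nsum_col (X : {set E}) : Nsum V X = (\sum_(j < n) (col j V \in X))%N.
Proof.
rewrite /Nsum; under eq_bigr => c _ do rewrite /ncard -sum1_card.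
by rewrite (sum_Jset X (fun _ _ => 1%N)) big_mkcond; apply: eq_bigr => j _;
  case: ifP.
Qed.

Lemma OPT_sum : OPT A k = (\sum_(j < n) hw (col j A - U *m col j V))%N.
Proof.
by rewrite -hopt hw_col; apply: eq_bigr => j _; rewrite linearB /= !colE mulmxA.
Qed.

(** The nearest column is no farther away than any column indexed by [Jset V c], hence no farther
    than their average; if there is none, the default d bounds every distance. *)
Lemma hw_nearest_le c :
  (hw (col (nn (U *m c)) A - U *m c))%:R <= Mavg A U V c.
Proof.
rewrite /Mavg; case: ifP => [n0|_]; last first.
  by rewrite ler_nat (leq_trans (hw_le _)) ?muln1.
rewrite ler_pdivlMr ?ltr0n // -natrM ler_nat /ncard mulnC -sum_nat_const.
by apply: leq_sum => j _; apply: hnn.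
Qed.

Lemma Err_basis s : free s -> size s = k ->
  (Err A U nn s <= OPT A k +
    \sum_(i < size s) Nsum V (Xset s i) * hw (col (nn (U *m s`_i)) A - U *m
      s`_i))%N.
Proof.
move=> fs ss.
have spanT c : c \in <<s>>%VS.
  have /eqP -> : <<s>>%VS == fullv.
    by rewrite eqEdim subvf /= (eqP fs) ss dimvf /dim /= muln1.
  exact: memvf.
pose q := coord (in_tuple s).
have qE c : c = \sum_i q i c *: s`_i by exact: (@coord_span _ _ _ (in_tuple s)
  c (spanT c)).
have qX (i : 'I_(size s)) c : (c \in Xset s i) = (q i c == 1).
  have h0 := free_but fs (ltn_ord i).
  have hH c' : (c' \in <<take i s ++ drop i.+1 s>>%VS) = (q i c' == 0).
    have restH j : j != i -> s`_j \in take i s ++ drop i.+1 s.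
      move=> ji; have := mem_nth 0 (ltn_ord j).
      rewrite (perm_mem (perm_but (ltn_ord i))) inE.
      by rewrite nth_uniq ?free_uniq // val_eqE (negPf ji).
    have qH : c' - q i c' *: s`_i \in <<take i s ++ drop i.+1 s>>%VS.
      rewrite {1}(qE c') (bigD1 i) //= addrAC subrr add0r.
      by apply: memv_suml => j ji; rewrite memvZ // memv_span // restH.
    apply/idP/eqP => [cH|q0]; last by rewrite q0 scale0r subr0 in qH.
    have := memvB cH qH; rewrite subKr.
    by case: (F2_cases (q i c')) => -> //; rewrite scale1r (negPf h0).
  rewrite XsetE hH /q linearD /= (coord_free (X := in_tuple s) i i fs) eqxx.
  by move: (coord _ i c) => a; case: (F2_cases a) => ->.
apply: leq_trans (minval_le _ _ (\matrix_(i < size s, j < n) q i (col j V))) _.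
rewrite hw_col OPT_sum.
under [X in (_ <= _ + X)%N]eq_bigr => i _ do rewrite Nsum_col big_distrl /=.
rewrite exchange_big -big_split leq_sum //= => j _.
(* Replacing each U b_i by a_(U b_i) in U v_j = sum of q_i U b_i adds one correction per nonzero
   coordinate; signs do not matter over GF(2). *)
have -> : col j (A - A_UB A U nn s *m (\matrix_(i < size s, j < n) q i (col j
  V))) =
   (col j A - U *m col j V) + 
     \sum_(i < size s) q i (col j V) *: (col (nn (U *m s`_i)) A - U *m s`_i).
  have -> : \sum_(i < size s) q i (col j V) *: (col (nn (U *m s`_i)) A - U *m
    s`_i)
      = col j (A_UB A U nn s *m (\matrix_(i < size s, j < n) q i (col j V)))
        - U *m col j V.
    under eq_bigr => i _ do rewrite scalerBr.
    rewrite sumrB; congr (_ - _).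
      apply/colP => x; rewrite summxE !mxE; apply: eq_bigr => i _.
      by rewrite !mxE mulrC.
    rewrite [in RHS](qE (col j V)) linear_sum /=.
    by apply: eq_bigr => i _; rewrite -scalemxAr.
  rewrite linearB /= -[- col j (_ *m _)]oppmx_F2 opprK.
  by rewrite addrACA -opprD addmx_F2 subr0.
rewrite (leq_trans (hwD _ _)) // leq_add2l (leq_trans (hw_sum _)) //.
by apply: leq_sum => i _; rewrite hwZ qX.
Qed.

(** * The bound and its change when a vector is appended *)

Local Notation wt c := ((ncard V c)%:R : rat).
Local Notation loss c := ((Lsum A U V c)%:R : rat).

(** The bound of the theorem for an arbitrary list, so that the induction can append vectors to
    it. *)
Definition err_bound r s : rat :=
  (OPT A k)%:R + lambda r * (\sum_(c in spanC s) loss c)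
  + \sum_(i < size s) fcoef V s i * Mavg A U V s`_i.

(** X_i grows by its translate b + X_i, which is disjoint from it because [b] is outside the span of
    the vectors other than the i-th. *)
Lemma Nsum_Xset_rcons s b (i : nat) : b \notin <<s>>%VS -> (i < size s)%N ->
  (Nsum V (Xset (rcons s b) i))%:R =
  (Nsum V (Xset s i))%:R + \sum_(x in Xset s i) wt (b + x) :> rat.
Proof.
move=> bs hi; rewrite /Nsum !natr_sum.
have bH : b \notin <<take i s ++ drop i.+1 s>>%VS.
  by apply: contra bs => h; rewrite (span_butE hi) memv_add_line h.
have XE c : (c \in Xset (rcons s b) i) = (c \in Xset s i) || (b + c \in Xset s
  i).
  have tE : take i (rcons s b) = take i s by rewrite -cats1 takel_cat // ltnW.
  by rewrite !XsetE nth_rcons hi tE drop_rcons // -rcons_cat span_rcons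
    memv_add_line addrCA.
rewrite (bigID (mem (Xset s i))) /=; congr (_ + _).
  by apply: eq_bigl => c; rewrite XE; case: (c \in Xset s i); rewrite ?andbF.
rewrite [LHS](reindex_inj (addrI b)) /=; apply: eq_bigl => c.
rewrite XE addrA addmx_F2 add0r; case cX: (c \in _);
  rewrite ?orbF ?andbN ?orbT //=.
apply/negP => h; move: bH; rewrite !XsetE in cX h.
by move: h; rewrite addrCA (rpredDr _ cX) => ->.
Qed.

(** Let C = b + S. Since Y loses C, f_i gains the mass of b + X_i and loses N_C / 2. The set X of
    the new vector is C itself, so its coefficient is N_C + (N_Y - N_C) / 2. *)
Lemma err_bound_rcons r s b : b \notin <<s>>%VS ->
  err_bound r (rcons s b) =
  (OPT A k)%:R
  + lambda r * (\sum_(c in spanC s) loss c - \sum_(v in <<s>>%VS) loss (b + v))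
  + \sum_(i < size s) (fcoef V s i + \sum_(x in Xset s i) wt (b + x)
       - 2^-1 * \sum_(v in <<s>>%VS) wt (b + v)) * Mavg A U V s`_i
  + 2^-1 * ((Nsum V (spanC s))%:R + \sum_(v in <<s>>%VS) wt (b + v))
     * Mavg A U V b.
Proof.
move=> bs; rewrite /err_bound size_rcons big_ord_recr /= (sum_spanC_rcons _ bs)
  addrA.
have NE : (Nsum V (spanC (rcons s b)))%:R =
    (Nsum V (spanC s))%:R - \sum_(v in <<s>>%VS) wt (b + v).
  by rewrite /Nsum !natr_sum sum_spanC_rcons.
congr (_ + _ + _).
  apply: eq_bigr => i _; rewrite nth_rcons ltn_ord /fcoef NE Nsum_Xset_rcons //.
  by congr (_ * _); ring.
rewrite nth_rcons ltnn eqxx; congr (_ * _); rewrite /fcoef NE.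
have -> : (Nsum V (Xset (rcons s b) (size s)))%:R = \sum_(v in <<s>>%VS) wt (b
  + v).
  rewrite /Nsum natr_sum -(sum_coset <<s>>%VS (fun c => wt c));
    apply: eq_bigl => c.
  rewrite XsetE nth_rcons ltnn eqxx -cats1 takel_cat // take_size drop_oversize
    ?cats0 //.
  by rewrite size_cat addn1.
by field.
Qed.

Lemma Mavg_ge0 c : 0 <= Mavg A U V c.
Proof. by rewrite /Mavg; case: ifP => _; rewrite ?divr_ge0 ?ler0n. Qed.

Lemma wt0_loss0 c : ncard V c = 0%N -> Lsum A U V c = 0%N.
Proof. by move=> /cards0_eq h; rewrite /Lsum h big_set0. Qed.

Lemma wt_Mavg c : wt c * Mavg A U V c = loss c.
Proof.
rewrite /Mavg; case: posnP => [n0|n0]; first by rewrite wt0_loss0 // n0 mul0r.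
by rewrite mulrC divfK // pnatr_eq0 -lt0n.
Qed.

Lemma coset_average r s b (x := \sum_(v in <<s>>%VS) wt (b + v))
    (y := \sum_(v in <<s>>%VS) loss (b + v)) :
  free s -> b \notin <<s>>%VS ->
  \sum_(v in <<s>>%VS) wt (b + v) * err_bound r (rcons s (b + v)) <=
  x * ((OPT A k)%:R + \sum_(i < size s) fcoef V s i * Mavg A U V s`_i)
  + (2^-1 * ((Nsum V (spanC s))%:R + x) * y
     + x * (lambda r * (\sum_(c in spanC s) loss c - y))).
Proof.
move=> fs bs.
set N := (Nsum V _)%:R; set L := \sum_(c in spanC s) _.
(* The part of the bound that is the same for every member [b + v] of the coset. *)
pose K : rat := (OPT A k)%:R + lambda r * (L - y)
  + \sum_(i < size s) (fcoef V s i - 2^-1 * x) * Mavg A U V s`_i.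
pose NX (i : nat) v : rat := \sum_(z in Xset s i) wt (b + v + z).
have termE v : v \in <<s>>%VS ->
    wt (b + v) * err_bound r (rcons s (b + v)) =
    wt (b + v) * K + \sum_(i < size s) Mavg A U V s`_i * (wt (b + v) * NX i v)
    + 2^-1 * (N + x) * loss (b + v).
  move=> vs; rewrite err_bound_rcons ?rpredDr //.
  have trans (F : E -> rat) :
      \sum_(u in <<s>>%VS) F (b + v + u) = \sum_(u in <<s>>%VS) F (b + u).
    rewrite -(sum_translate (fun u => F (b + u)) vs).
    by apply: eq_bigr => u _; rewrite addrA.
  rewrite (trans (fun c => wt c)) (trans (fun c => loss c)) -/x -/y -/N -/L.
  rewrite -wt_Mavg.
  rewrite [in LHS](eq_bigr (fun i : 'I_(size s) =>
    (fcoef V s i - 2^-1 * x) * Mavg A U V s`_i + NX i v * Mavg A U V s`_i));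
      last first.
    by move=> i _; rewrite /NX; ring.
  rewrite big_split /=.
  have -> : \sum_(i < size s) Mavg A U V s`_i * (wt (b + v) * NX i v) =
      wt (b + v) * \sum_(i < size s) NX i v * Mavg A U V s`_i.
    by rewrite mulr_sumr; apply: eq_bigr => i _; ring.
  by rewrite /K; ring.
rewrite (eq_bigr _ termE) !big_split /= -mulr_suml -mulr_sumr -/x -/y
  exchange_big /=.
(* [NX i v] is the mass of the half of the coset opposite to [b + v]. Its weighted sum is at most
   x^2 / 2, which the term -x / 2 inside [K], summed with total weight x, cancels. *)
have cross (i : 'I_(size s)) : 
    \sum_(v in <<s>>%VS) Mavg A U V s`_i * (wt (b + v) * NX i v)
    <= Mavg A U V s`_i * (2^-1 * x ^+ 2).
  rewrite -mulr_sumr ler_wpM2l ?Mavg_ge0 //.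
  have := coset_cross_le (fun c => wt c) b (free_but fs (ltn_ord i)).
  rewrite -span_butE // -/x; congr (_ <= _); apply: eq_bigr => v _.
  by congr (_ * _); apply: eq_bigl => c; rewrite XsetE.
have : \sum_(i < size s) \sum_(v in <<s>>%VS) Mavg A U V s`_i * (wt (b + v) *
  NX i v)
    <= (\sum_(i < size s) Mavg A U V s`_i) * (2^-1 * x ^+ 2).
  by rewrite mulr_suml; apply: ler_sum => i _; apply: cross.
have -> : K = (OPT A k)%:R + lambda r * (L - y)
    + (\sum_(i < size s) fcoef V s i * Mavg A U V s`_i
       - 2^-1 * x * \sum_(i < size s) Mavg A U V s`_i).
  rewrite /K [_ * x * _]mulr_sumr -sumrB; congr (_ + _).
  by apply: eq_bigr => i _; rewrite mulrBl.
rewrite -subr_ge0 => h; rewrite -subr_ge0; move: h; congr (0 <= _); ring.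
Qed.

(** * Choosing the next vector, and the induction *)

Lemma card_span s : free s -> #|<<s>>%VS| = (2 ^ size s)%N.
Proof. by move=> /eqP fs; rewrite card_vspace card_ord fs. Qed.

(** S has codimension r, hence 2^r cosets, and Y consists of all of them but S. *)
Lemma card_spanC s r : free s -> (size s + r)%N = k ->
  #|spanC s|%:R = (2 ^+ r - 1) * #|<<s>>%VS|%:R :> rat.
Proof.
move=> fs sr; apply: (addrI (#|<<s>>%VS|%:R)).
have -> : #|<<s>>%VS|%:R + #|spanC s|%:R = 2 ^+ size s * 2 ^+ r :> rat.
  rewrite -natrD -!natrX -natrM -expnD sr; congr _%:R.
  rewrite -(cardsE (mem <<s>>%VS)) cardsC.
  by rewrite card_mx card_ord muln1.
by rewrite card_span // natrX; ring.
Qed.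

Lemma err_bound_step r s : free s -> (size s + r.+1)%N = k ->
  exists2 b, b \notin <<s>>%VS & err_bound r (rcons s b) <= err_bound r.+1 s.
Proof.
move=> fs sr.
have m0 : 0 < (2 : rat) ^+ r.+1 - 1 by rewrite subr_gt0 exprn_egt1 // ltr1n.
have w0 : 0 < (#|<<s>>%VS|%:R : rat) by rewrite card_span // ltr0n expn_gt0.
have cY := card_spanC fs sr.
pose x b := \sum_(v in <<s>>%VS) wt (b + v).
pose y b := \sum_(v in <<s>>%VS) loss (b + v).
have YE c : (c \in spanC s) = (c \notin <<s>>%VS) by rewrite !inE.
have NE : (Nsum V (spanC s))%:R = \sum_(c in spanC s) wt c by rewrite /Nsum
  natr_sum.
(* If no column of [V] lies in Y, there are no weights to average with. Any [b] in Y then works: all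
   masses and losses in Y are 0, and so is the coefficient of M_b. *)
have [N0|N0] := posnP (Nsum V (spanC s)).
  have [b bY] : exists b, b \in spanC s.
    by apply/card_gt0P; rewrite -(ltr0n rat) cY mulr_gt0.
  have bs : b \notin <<s>>%VS by rewrite -YE.
  exists b => //.
  have n0 c : c \in spanC s -> ncard V c = 0%N.
    by move/eqP: N0; rewrite /Nsum sum_nat_eq0 => /forall_inP h /h /eqP.
  have bvY v : v \in <<s>>%VS -> b + v \in spanC s by move=> vs;
    rewrite YE rpredDr.
  have x0 : \sum_(v in <<s>>%VS) wt (b + v) = 0.
    by rewrite big1 // => v vs; rewrite n0 // bvY.
  have X0 (i : 'I_(size s)) : \sum_(z in Xset s i) wt (b + z) = 0.
    rewrite big1 // => z; rewrite XsetE => zX; rewrite n0 // bvY //.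
    by rewrite (span_butE (ltn_ord i)) memv_add_line zX orbT.
  rewrite err_bound_rcons // x0 N0 addr0 mulr0 mul0r addr0 /err_bound.
  have -> : \sum_(c in spanC s) loss c = 0.
    by rewrite big1 // => c cs; rewrite wt0_loss0 // n0.
  have -> : \sum_(v in <<s>>%VS) loss (b + v) = 0.
    by rewrite big1 // => v vs; rewrite wt0_loss0 // n0 // bvY.
  rewrite subrr !mulr0 lerD2l; apply: ler_sum => i _.
  by rewrite X0 subr0 addr0.
have delta0 : 0 < 2^-1 - (lambda r - 2^-1) / (2 ^+ r.+1 - 1).
  rewrite subr_gt0 ltr_pdivrMr //; have := lambda_lt r; rewrite exprS; lra.
have [b [bY xb le]] : exists b, [/\ b \in spanC s, 0 < x b &
    2^-1 * ((Nsum V (spanC s))%:R + x b) * y b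
      + x b * (lambda r * (\sum_(c in spanC s) loss c - y b))
    <= x b * (lambda r.+1 * \sum_(c in spanC s) loss c)].
  rewrite lambda_recS.
  apply: (weighted_choice (w := #|<<s>>%VS|%:R)) => //.
  - by move=> b _; apply: sumr_ge0.
  - by move=> b _; apply: sumr_ge0.
  - by rewrite (sum_Y_coset (fun c => wt c) YE) NE mulr_natl.
  - by rewrite (sum_Y_coset (fun c => loss c) YE) mulr_natl.
  - by rewrite ltr0n.
  - by apply: sumr_ge0.
  (* At r = 0 convexity fails, but Y is a single coset: [rcons s b] is a basis, so its span has
     empty complement and [x b] is all of N_Y. *)
  case: r sr {m0 cY delta0} => [|r] sr; last by left; apply: lambda_ge_half.
  right; split=> // b; rewrite YE => bs.
  have fb : free (rcons s b) by rewrite free_rcons bs.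
  have := sum_spanC_rcons (fun c => wt c) bs.
  rewrite -/(x b) -NE big_pred0 => [|c]; first by move/esym/eqP;
    rewrite subr_eq0 => /eqP.
  have: #|spanC (rcons s b)|%:R = 0 :> rat.
    by rewrite (card_spanC (r := 0) fb) ?size_rcons ?addn0 -?addn1 // subrr
      mul0r.
  by move/eqP; rewrite pnatr_eq0 cards_eq0 => /eqP ->; rewrite inE.
have bs : b \notin <<s>>%VS by rewrite -YE.
(* The chosen coset meets the bound only on average, so a suitable member of it remains to be
   selected. *)
have [v vs bv] : exists2 v, v \in <<s>>%VS &
    err_bound r (rcons s (b + v)) <= err_bound r.+1 s.
  apply: (exists_le_average (w := fun v => wt (b + v))) => //.
  apply: le_trans (coset_average r fs bs) _; rewrite -/(x b) -/(y b).
  by apply: le_trans (lerD (lexx _) le) _; rewrite -mulrDr /err_bound addrAC.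
by exists (b + v) => //; rewrite rpredDr.
Qed.

Lemma Err_rec_le_err_bound r s : free s -> (size s + r)%N = k ->
  (Err_rec A U nn r s)%:R <= err_bound r s.
Proof.
elim: r s => [|r IH] s fs sr.
  rewrite addn0 in sr; apply: le_trans (_ : _ <= _%:R) _.
    by rewrite ler_nat; apply: Err_basis.
  rewrite natrD natr_sum /err_bound /lambda mul0r addr0 lerD2l.
  (* The half of N_Y in [fcoef] is nonnegative, so f_i is at least the N_(X_i) obtained from
     [Err_basis]. *)
  apply: ler_sum => i _; rewrite natrM ler_pM ?hw_nearest_le // /fcoef lerDl.
  by rewrite mulr_ge0.
have [b bs le] := err_bound_step fs sr.
apply: le_trans le; apply: le_trans (IH _ _ _); last first.
- by rewrite size_rcons addSnnS.
- by rewrite free_rcons bs.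
by rewrite ler_nat /=;
  apply: (minval_le _ (fun b => Err_rec A U nn r (rcons s b))).
Qed.

End Fixed.

Theorem theorem3 (d n k : nat) (hk : (1 <= k)%N)
    (A : 'M['F_2]_(d, n)) (U : 'M['F_2]_(d, k)) (V : 'M['F_2]_(k, n))
    (hopt : optimal A U V)
    (nn : 'cV['F_2]_d -> 'I_n) (hnn : nearest A nn)
    (b : k.-tuple 'cV['F_2]_k) (hb : free b)
    (r : nat) (hr : (r <= k)%N) :
  let s := take (k - r) b in
  (Err_rec A U nn r s)%:R <=
    (OPT A k)%:R
    + lambda r * (\sum_(c in spanC s) (Lsum A U V c)%:R)
    + \sum_(i < k - r) fcoef V s i * Mavg A U V s`_i :> rat.
Proof.
cbv zeta; set s := take _ _.
have ss : size s = (k - r)%N by rewrite size_takel // size_tuple leq_subr.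
have fs : free s by move: hb;
  rewrite -{1}(cat_take_drop (k - r) b) => /catl_free.
by rewrite -ss; apply: Err_rec_le_err_bound => //; rewrite ss subnK.
Qed.
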